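(* For every positive integer $n$, there is a graph $G$ with $n$ vertices and at most $n(1+b(n))$ edges such that the majority problem on $G$ can be solved and $m(G)=n-b(n)$.
   Context: $b(n)$ denotes the number of $1$'s in the binary representation of $n$. Let $G$ be a finite graph on $n$ vertices whose vertices are colored with two colors (red and blue) in an unknown way. A vertex is a majority vertex if its color class contains more than $n/2$ vertices. A query is an edge $uv$ of $G$; the answer tells whether $u$ and $v$ have the same color (SAME) or different colors (DIFF). Queries are adaptive (each query may depend on the previous answers), and the algorithm is deterministic. The majority problem on $G$ is to find a majority vertex or to show that none exists; it is solvable (with any number of queries) if and only if $G$ is connected when $n$ is even, and if and only if $G$ has at most two components when $n$ is odd. For such $G$, $m(G)$ denotes the least number of queries needed in the worst case (over all colorings) to solve the majority problem on $G$. *)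

(* Defs.v *)
From mathcomp Require Import all_boot.

Set Implicit Arguments.
Unset Strict Implicit.
Unset Printing Implicit Defensive.

(* [2 ^ i <= n] forces [i < n], so the range [i < n] covers every binary digit. *)
Definition binary_ones (n : nat) : nat := \sum_(i < n) odd (n %/ 2 ^ i).

Record sgraph (T : finType) := SGraph {
  adj : rel T;
  adj_sym : symmetric adj;
  adj_irrefl : irreflexive adj
}.

Definition edges (T : finType) (G : sgraph T) : {set {set T}} :=
  [set [set x; y] | x in [set: T], y in [set: T] & adj G x y].

Definition coloring (T : finType) : Type := {ffun T -> bool}.

Definition majority_vertex (T : finType) (c : coloring T) (v : T) : bool :=
  #|T| < 2 * #|[set u | c u == c v]|.

(* Deterministic adaptive algorithms as decision trees.  [Answer (Some v)]
   declares [v] to be a majority vertex and [Answer None] declares that there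
   is none; [Query u v s d] continues with [s] on SAME and with [d] on DIFF. *)
Inductive algorithm (T : Type) : Type :=
| Answer of option T
| Query of T & T & algorithm T & algorithm T.

Arguments Answer {T} _.
Arguments Query {T} _ _ _ _.

Fixpoint queries_edges (T : finType) (G : sgraph T) (t : algorithm T) : bool :=
  match t with
  | Answer _ => true
  | Query u v s d => [&& adj G u v, queries_edges G s & queries_edges G d]
  end.

Fixpoint output (T : finType) (t : algorithm T) (c : coloring T) : option T :=
  match t with
  | Answer a => a
  | Query u v s d => if c u == c v then output s c else output d c
  end.

Fixpoint num_queries (T : finType) (t : algorithm T) (c : coloring T) : nat :=
  match t with
  | Answer _ => 0
  | Query u v s d =>
      (if c u == c v then num_queries s c else num_queries d c).+1
  end.

Definition correct_output (T : finType) (c : coloring T) (a : option T) : Prop :=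
  match a with
  | Some v => majority_vertex c v
  | None => forall v : T, ~~ majority_vertex c v
  end.

Definition solves_majority (T : finType) (G : sgraph T) (t : algorithm T) : Prop :=
  queries_edges G t /\ forall c : coloring T, correct_output c (output t c).

Definition majority_solvable (T : finType) (G : sgraph T) : Prop :=
  exists t : algorithm T, solves_majority G t.

Definition worst_case (T : finType) (t : algorithm T) : nat :=
  \max_(c : {ffun T -> bool}) num_queries t c.

(* [m(G) = k]: a relation rather than a function because [m(G)] is defined
   only when the majority problem on [G] is solvable. *)
Definition majority_complexity (T : finType) (G : sgraph T) (k : nat) : Prop :=
  (exists t : algorithm T, solves_majority G t /\ worst_case t = k) /\
  (forall t : algorithm T, solves_majority G t -> k <= worst_case t).

(* Main.v *)
Require Import Defs.
From mathcomp Require Import all_boot all_order all_algebra.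
From mathcomp Require Import zify ring.

Set Implicit Arguments.
Unset Strict Implicit.
Unset Printing Implicit Defensive.

Import GRing.Theory Num.Theory.

(** The value [n - b(n)] comes from two independent arguments; colours are
    encoded as signs, so that a colouring has a balance, the sum of its signs,
    and a majority vertex is one whose sign agrees with a nonzero balance.

    Lower bound, for every graph ([worst_case_lower]). Fix a vertex [x] and let
    [X] be the sum, over the colourings with [x] positive, of the sign of the
    balance. For a correct algorithm this sign is the sign of the declared
    vertex. The indicator of an answer to a query [u v] is
    [(1 + s_u s_v) / 2] or [(1 - s_u s_v) / 2], so the indicator of a node at
    depth [d] of the decision tree is [2 ^ -d] times an integer combination of
    characters (products of signs), and a character sums to [0] or [2 ^ n] over
    all colourings. Hence [2 ^ n] divides [2 ^ d * 2 X] when [d] is the depth.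
    On the other hand [2 X] is a central binomial coefficient, doubled when [n]
    is odd, and by Legendre's formula the exponent of [2] in it is exactly
    [b(n)] ([sum_sgz_balance], [logn2_central]). So [d >= n - b(n)].

    Upper bound ([solvable_hub_tree]). At level [j], the vertices split into
    [n %/ 2 ^ j] aligned intervals of length [2 ^ j], called nodes, plus a
    remainder. On the complete graph one repeatedly compares two monochromatic
    clusters of size [2 ^ j]: they merge or cancel. Here a node may only be
    compared with its sibling interval, by an edge joining their left ends,
    unless one of the two clusters is represented by a hub, a vertex adjacent
    to all others. There is one hub per binary digit [1] of [n]: the left end
    of the last interval at each level with an odd number of intervals. These
    are the graph [hub_tree n] and its [n * (1 + b(n))] edges.

    When a node cancels, its sibling can be left without a partner. One fixed
    hub [h] serves as an accumulator that absorbs such lone nodes; its weight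
    is an integer multiple [a] of [2 ^ j]. The point is that the budget
    [N - b(N)], with [N = n %/ 2 ^ j], does not depend on how many nodes are
    dead: since [N - b(N) = N./2 + (N./2 - b(N./2))], each level may spend one
    query per pair of siblings, and this is what is spent, either to compare
    two siblings or to absorb a lone node. For [a] to be even after the level,
    so that it survives to the next one, the number of units ([a] plus the
    number of alive nodes) must be even and no node may lie outside the pairs.
    If this number is odd, one alive node is set aside for good: at most one
    per level, so that all the nodes set aside weigh less than one unit of the
    next level, and they matter only if everything else cancels. If it is even
    and the unpaired last node is alive, that node is moved into a dead slot,
    which is legitimate because it is represented by a hub; a dead slot exists
    because [|a|] never exceeds the number of dead nodes, and otherwise
    [a = 0] and the number of units would be [N], which is odd. *)

(** * Binary digits and central binomials *)

Lemma binary_ones_widen n m :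
  n <= m -> \sum_(i < m) odd (n %/ 2 ^ i) = binary_ones n.
Proof.
move=> le_nm; rewrite /binary_ones.
rewrite (big_ord_widen m (fun i => odd (n %/ 2 ^ i) : nat) le_nm).
rewrite [RHS]big_mkcond; apply: eq_bigr => i _; case: ltnP => // le_ni.
by rewrite divn_small // (leq_ltn_trans le_ni) // ltn_expl.
Qed.

Lemma binary_ones_half n : binary_ones n = odd n + binary_ones n./2.
Proof.
rewrite -(binary_ones_widen (leqnSn n)) big_ord_recl divn1; congr (_ + _).
have le_half : n./2 <= n by lia.
rewrite -(binary_ones_widen le_half); apply: eq_bigr => i _.
by rewrite /= expnS divnMA divn2.
Qed.

Lemma binary_ones_leq n : binary_ones n <= n.
Proof.
have /leq_trans -> // : binary_ones n <= \sum_(i < n) 1.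
  by apply: leq_sum => i _; rewrite leq_b1.
by rewrite sum1_card card_ord.
Qed.

Lemma logn2_double_fact m : logn 2 (m.*2)`! = m + logn 2 m`!.
Proof.
elim: m => [|m IHm]; first by [].
rewrite doubleS !factS !lognM ?fact_gt0 ?muln_gt0 ?fact_gt0 //.
rewrite IHm -doubleS -muln2 lognM // (pfactorK 1 (erefl : prime 2)).
have -> : logn 2 m.*2.+1 = 0 by rewrite logn_coprime // coprime2n /= odd_double.
lia.
Qed.

(** Legendre's formula for the prime [2]: halving [n] drops one binary digit
    and removes [n./2] factors [2] from the factorial. *)
Lemma logn2_fact n : logn 2 n`! + binary_ones n = n.
Proof.
elim/ltn_ind: n => -[|n] IHn; first by rewrite /binary_ones big_ord0.
have /IHn IH : n.+1./2 < n.+1 by lia.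
suff -> : logn 2 n.+1`! = n.+1./2 + logn 2 (n.+1./2)`!.
  rewrite binary_ones_half; lia.
rewrite -logn2_double_fact; case: (boolP (odd n.+1)) => [odd_n|even_n].
  have En : n = n.+1./2.*2 by lia.
  by rewrite factS lognM ?fact_gt0 // logn_coprime ?coprime2n // {1}En.
by congr (logn 2 _`!); lia.
Qed.

Lemma logn2_central m : logn 2 'C(m.*2, m) = binary_ones m.
Proof.
have le_m : m <= m.*2 by lia.
have Em : m.*2 - m = m by lia.
have := congr1 (logn 2) (bin_fact le_m).
rewrite Em !lognM ?bin_gt0 ?muln_gt0 ?fact_gt0 //.
rewrite logn2_double_fact; have := logn2_fact m; lia.
Qed.

(** * Colours as signs *)

Definition sign (b : bool) : int := (if b then 1 else -1)%R.

Definition balance (T : finType) (c : coloring T) : int :=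
  (\sum_(u : T) sign (c u))%R.

Lemma sign_balance (T : finType) (c : coloring T) (b : bool) :
  (sign b * balance c = (2 * #|[set u | c u == b]|)%N%:Z - #|T|%:Z)%R.
Proof.
set A := [set u | c u == b].
rewrite /balance mulr_sumr (bigID (mem A)) /=.
rewrite (eq_bigr (fun=> 1%R)) => [|u]; last first.
  by rewrite inE => /eqP ->; case: b {A}.
rewrite [X in (_ + X)%R](eq_bigr (fun=> (-1)%R)) => [|u]; last first.
  by rewrite inE; case: b {A}; case: (c u).
rewrite !sumr_const -(cardsC A).
have -> : #|[pred u | u \notin A]| = #|~: A| by apply: eq_card => u; rewrite !inE.
lia.
Qed.

Lemma majority_vertexE (T : finType) (c : coloring T) (v : T) :
  majority_vertex c v = (0 < sign (c v) * balance c)%R.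
Proof. by rewrite sign_balance /majority_vertex; lia. Qed.

(** * Characters and decision trees *)

(** The declared answer as a function with values in {-1, 0, 1}: a correct
    algorithm computes the sign of the balance in this way. *)
Definition output_sign (T : finType) (t : algorithm T) (c : coloring T) : int :=
  if output t c is Some v then sign (c v) else 0%R.

Lemma output_sign_correct (T : finType) (t : algorithm T) (c : coloring T) :
  correct_output c (output t c) -> output_sign t c = sgz (balance c).
Proof.
rewrite /output_sign; case: (output t c) => [v|] /=.
  by rewrite majority_vertexE /sign; case: (c v); lia.
move=> no_maj; case: (pickP (fun _ : T => true)) => [v _|T0].
  have [u cu | c_all] := pickP (fun u => c u != c v).
    have := no_maj u; have := no_maj v; move: cu.
    by rewrite !majority_vertexE /sign; case: (c v); case: (c u) => //; lia.
  have := no_maj v; rewrite majority_vertexE sign_balance.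
  have -> : [set u | c u == c v] = [set: T].
    by apply/setP => u; rewrite !inE; have /negbFE := c_all u.
  have : 0 < #|T| by apply/card_gt0P; exists v.
  by rewrite cardsT; lia.
by rewrite /balance big1 // => u; have := T0 u.
Qed.

Definition character (T : finType) (e : T -> nat) (c : coloring T) : int :=
  (\prod_(u : T) sign (c u) ^+ e u)%R.

Lemma character_mul_sign (T : finType) (e : T -> nat) (c : coloring T) (v : T) :
  (character e c * sign (c v) = character (fun u => e u + (u == v))%N c)%R.
Proof.
rewrite /character.
under [RHS]eq_bigr => u _ do rewrite exprD.
rewrite big_split /=; congr (_ * _)%R.
by rewrite (bigD1 v) //= eqxx expr1 big1 ?mulr1 // => u /negbTE ->.
Qed.

Lemma character_sum (T : finType) (e : T -> nat) :
  ((2 ^ #|T|)%N%:Z %| (\sum_(c : coloring T) character e c)%R)%Z.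
Proof.
rewrite -(bigA_distr_bigA (fun u b => sign b ^+ e u)%R).
have -> : ((2 ^ #|T|)%N%:Z = \prod_(u : T) 2%:Z)%R.
  by rewrite prodr_const -[LHS]natz natrX natz.
apply: (big_ind2 (fun a b => (a %| b)%Z)) => // [*|u _]; first exact: dvdz_mul.
by rewrite big_bool /= expr1n -signr_odd; case: (odd _).
Qed.

(** The indicator of [S] has all its Fourier coefficients in
    [2 ^ - k] times the integers. *)
Definition divisible_spectrum (T : finType) (k : nat) (S : pred (coloring T)) : Prop :=
  forall e : T -> nat,
    ((2 ^ #|T|)%N%:Z %| (2 ^+ k * \sum_(c | S c) character e c)%R)%Z.

(** If [S'] is cut out of [S] by the value of a character, its indicator is that
    of [S] times [(1 + b * character) / 2], which costs one factor [2]. *)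
Lemma divisible_spectrum_split (T : finType) k (S S' : pred (coloring T)) (b : int)
    (e0 : T -> nat) :
  divisible_spectrum k S -> (b = 1 \/ b = -1)%R ->
  (forall c, S c -> character e0 c = b * (if S' c then 1 else -1))%R ->
  divisible_spectrum k.+1 (fun c => S c && S' c).
Proof.
move=> smS bE e0E e.
have -> : (2 ^+ k.+1 * \sum_(c | S c && S' c) character e c =
    2 ^+ k * (\sum_(c | S c) character e c) +
    b * (2 ^+ k * \sum_(c | S c) character (fun u => (e u + e0 u)%N) c))%R.
  rewrite exprSr mulrCA -mulrDr -mulrA; congr (_ * _)%R.
  rewrite !mulr_sumr -big_split big_mkcondr; apply: eq_bigr => c Sc /=.
  have -> : character (fun u => e u + e0 u)%N c =
      (character e c * character e0 c)%R.
    by rewrite /character -big_split; apply: eq_bigr => u _; rewrite exprD.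
  by rewrite e0E //; case: bE => ->; case: (S' c); ring.
by apply: rpredD; [exact: smS | apply: dvdz_mull; exact: smS].
Qed.

(** [S] stands for the colourings that reach the current node, at depth [k].
    Bounding [k + num_queries] over [S] only, instead of the depth of the tree,
    lets branches with contradictory answers be arbitrarily deep: there [S] is
    empty and the sum vanishes. *)
Lemma divisible_spectrum_output (T : finType) (t : algorithm T) d k
    (S : pred (coloring T)) :
  divisible_spectrum k S -> (forall c, S c -> k + num_queries t c <= d) ->
  forall e : T -> nat, ((2 ^ #|T|)%N%:Z %|
    (2 ^+ d * \sum_(c | S c) character e c * output_sign t c)%R)%Z.
Proof.
elim: t k S => [a|u v s IHs t IHt] k S smS le_d e.
  have [c Sc | S0] := pickP S; last by rewrite big_pred0 // mulr0.
  have /subnK <- : k <= d by have := le_d c Sc; rewrite addn0.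
  rewrite exprD -mulrA; apply: dvdz_mull; case: a {le_d} => [v|]; last first.
    by rewrite big1 ?mulr0 // => ? _; rewrite mulr0.
  rewrite (eq_bigr (character (fun u => (e u + (u == v))%N))); first exact: smS.
  by move=> c' _; rewrite -character_mul_sign.
rewrite (bigID (fun c : coloring T => c u == c v)) /= mulrDr.
pose e0 w := ((w == u) + (w == v))%N.
have e0E (c : coloring T) : character e0 c = (if c u == c v then 1 else -1)%R.
  rewrite -character_mul_sign -[X in character X]/(fun w => (0 + (w == u))%N).
  rewrite -character_mul_sign /character big1 // mul1r.
  by case: (c u); case: (c v).
apply: rpredD.
- rewrite (eq_bigr (fun c => character e c * output_sign s c)%R); last first.
    by move=> c /andP[_ uv]; rewrite /output_sign /= uv.
  apply: (IHs k.+1); first by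
    apply: (divisible_spectrum_split smS (or_introl erefl) (e0 := e0)) => c _;
    rewrite mul1r.
  by move=> c /andP[/le_d /= + uv]; rewrite uv addnS.
- rewrite (eq_bigr (fun c => character e c * output_sign t c)%R); last first.
    by move=> c /andP[_ /negbTE uv]; rewrite /output_sign /= uv.
  apply: (IHt k.+1); first by
    apply: (divisible_spectrum_split smS (or_intror erefl) (e0 := e0)) => c _;
    rewrite e0E; case: eqP.
  by move=> c /andP[/le_d /= + /negbTE uv]; rewrite uv addnS.
Qed.

(** * The majority sum and the lower bound *)

Lemma card_sets_containing (T : finType) (x : T) k :
  #|[set A : {set T} | x \in A & #|A| == k.+1]| = 'C(#|T|.-1, k).
Proof.
have cT : #|T| = #|T|.-1.+1 by rewrite prednK //; apply/card_gt0P; exists x.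
have all_sets : #|[set A : {set T} | #|A| == k.+1]| = 'C(#|T|, k.+1).
  by rewrite -[#|T|]cardsT -cards_draws; apply: eq_card => A; rewrite !inE subsetT.
have := cardsID [set A : {set T} | x \in A] [set A : {set T} | #|A| == k.+1].
rewrite all_sets cT binS addnC.
have -> : [set A : {set T} | #|A| == k.+1] :\: [set A : {set T} | x \in A] =
    [set A : {set T} | A \subset [set~ x] & #|A| == k.+1].
  by apply/setP => A; rewrite !inE subsetC sub1set inE.
rewrite cards_draws cardsC1 => /addnI <-.
by apply: eq_card => A; rewrite !inE andbC.
Qed.

Lemma sum_sets_containing (T : finType) (x : T) (F : nat -> int) :
  (\sum_(A : {set T} | x \in A) F #|A| =
   \sum_(k < #|T|) F k.+1 *+ 'C(#|T|.-1, k))%R.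
Proof.
have T_gt0 : 0 < #|T| by apply/card_gt0P; exists x.
have lt_pred (A : {set T}) : #|A|.-1 < #|T| by have := max_card A; lia.
rewrite (partition_big (fun A => Ordinal (lt_pred A)) xpredT) //=.
apply: eq_bigr => k _; rewrite -(card_sets_containing x) -sumr_const.
have same (A : {set T}) : (x \in A) && (Ordinal (lt_pred A) == k) =
    (A \in [set A : {set T} | x \in A & #|A| == k.+1]).
  rewrite inE; case: (boolP (x \in A)) => //= xA.
  have : 0 < #|A| by apply/card_gt0P; exists x.
  by rewrite -val_eqE /=; case: #|A|.
rewrite (eq_bigl _ _ same); apply: eq_bigr => A.
by rewrite inE => /andP[_ /eqP ->].
Qed.

(** Colourings with [x] positive and [k] other positive vertices have balance
    [2 (k + 1) - n]. Adding the terms for [k] and [n - 1 - k], which have the same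
    binomial weight, all signs cancel except around the middle. *)
Lemma sum_sgz_balance (T : finType) (x : T) :
  (2 * \sum_(c : coloring T | c x) sgz (balance c) =
   (2 ^ odd #|T| * 'C((#|T|./2).*2, #|T|./2))%N%:Z)%R.
Proof.
pose F k := sgz (k.*2%:Z - #|T|%:Z)%R.
have -> : (\sum_(c : coloring T | c x) sgz (balance c) =
    \sum_(A : {set T} | x \in A) F #|A|)%R.
  rewrite (reindex (fun A : {set T} => [ffun u => u \in A] : coloring T)); last first.
    exists (fun c : coloring T => [set u | c u]) => A _.
      by apply/setP => u; rewrite inE ffunE.
    by apply/ffunP => u; rewrite ffunE inE.
  apply: eq_big => [A|A _]; first by rewrite ffunE.
  rewrite -[balance _]mul1r -[1%R]/(sign true) sign_balance /F -mul2n.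
  by congr (sgz ((2 * _)%N%:Z - _)); apply: eq_card => u; rewrite inE ffunE eqb_id.
rewrite sum_sets_containing.
have : 0 < #|T| by apply/card_gt0P; exists x.
move: #|T| @F => [//|n] F _; rewrite [n.+1.-1]/=.
rewrite mulr_natl mulr2n [X in (_ + X)%R](reindex_inj rev_ord_inj) -big_split /=.
set h := n.+1./2; pose h' := h - ~~ odd n.+1.
have term (k : 'I_n.+1) :
    (F k.+1 *+ 'C(n, k) + F (n.+1 - k.+1).+1 *+ 'C(n, n.+1 - k.+1) =
     ((k == h :> nat) * 'C(n, k) + (k == h' :> nat) * 'C(n, k))%N%:Z)%R.
  rewrite subSS bin_sub; last by case: k.
  rewrite -mulrnDl -mulnDl PoszM -mulr_natr natz; congr (_ * _)%R.
  by have := ltn_ord k; rewrite /F /h' /h; lia.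
have pick i : i < n.+1 -> \sum_(k < n.+1) (k == i :> nat) * 'C(n, k) = 'C(n, i).
  move=> lt_i; rewrite (bigD1 (Ordinal lt_i)) //= eqxx mul1n big1 ?addn0 // => k.
  by rewrite -val_eqE /= => /negbTE ->.
rewrite (eq_bigr _ (fun k _ => term k)) -(big_morph Posz PoszD (erefl _)).
rewrite big_split /= !pick; try by rewrite /h' /h; lia.
congr Posz; rewrite /h' /h /=; case: (boolP (odd n)) => odd_n /=.
  rewrite mul1n subn1; have -> : (uphalf n).*2 = n.+1 by lia.
  have -> : uphalf n = (uphalf n).-1.+1 by lia.
  by rewrite binS.
have -> : (uphalf n).*2 = n by lia.
by rewrite subn0 addnn mul2n.
Qed.

(** Half of the colourings, those with [x] positive, are kept because negating a
    colouring negates its balance, so that the sum over all of them is zero. The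
    selection of [x] positive costs a factor [2], as one more query would. *)
Lemma worst_case_lower (T : finType) (x : T) (G : sgraph T) (t : algorithm T) :
  solves_majority G t -> #|T| - binary_ones #|T| <= worst_case t.
Proof.
case=> _ correct.
have sm0 : divisible_spectrum 0 (fun _ : coloring T => true).
  by move=> e; rewrite mul1r; exact: character_sum.
have sm1 : divisible_spectrum 1 (fun c : coloring T => c x).
  apply: (divisible_spectrum_split sm0 (or_introl erefl)
    (e0 := fun u => (0 + (u == x))%N)) => c _.
  by rewrite -character_mul_sign /character big1 // !mul1r; case: (c x).
have le_w (c : coloring T) : c x -> 1 + num_queries t c <= (worst_case t).+1.
  by move=> _; rewrite add1n ltnS /worst_case (leq_bigmax c).
have := divisible_spectrum_output sm1 le_w (fun=> 0).
rewrite (eq_bigr (fun c => sgz (balance c))); last first.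
  move=> c _; rewrite output_sign_correct // /character big1 ?mul1r // => u _.
rewrite exprSr -mulrA sum_sgz_balance -natrX natz -PoszM dvdzE /= => dvd.
have le_half : #|T|./2 <= #|T|./2.*2 by lia.
have := dvdn_leq_log 2 _ dvd.
rewrite !lognM ?muln_gt0 ?expn_gt0 ?bin_gt0 ?le_half //= ?andbT.
rewrite !pfactorK // logn2_central -binary_ones_half => /(_ isT).
by rewrite leq_subLR addnC.
Qed.

(** * Solving from partial knowledge *)

(** [K] is what is known about the colouring. Describing a state of the algorithm
    by a predicate avoids carrying the components of the queries already made:
    only the consequences of the answers for the balance are kept. *)
Definition solvable_within (T : finType) (G : sgraph T)
    (K : coloring T -> Prop) (q : nat) : Prop :=
  exists t : algorithm T, queries_edges G t /\
    forall c, K c -> correct_output c (output t c) /\ num_queries t c <= q.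

Lemma solvable_within_weaken (T : finType) (G : sgraph T)
    (K K' : coloring T -> Prop) q q' :
  (forall c, K' c -> K c) -> q <= q' ->
  solvable_within G K q -> solvable_within G K' q'.
Proof.
move=> sub le_q [t [tG tP]]; exists t; split=> // c /sub /tP[? ?].
by split=> //; apply: leq_trans le_q.
Qed.

(** The case [u = v] allows an uninformative query to be skipped, so that the
    representatives of distinct clusters need not be proved distinct. *)
Lemma solvable_within_query (T : finType) (G : sgraph T)
    (K : coloring T -> Prop) q (u v : T) :
  (u == v) || adj G u v ->
  solvable_within G (fun c => K c /\ c u = c v) q ->
  solvable_within G (fun c => K c /\ c u != c v) q ->
  solvable_within G K q.+1.
Proof.
case/orP=> [/eqP-> same _ | uv [s [sG sP]] [d [dG dP]]].
  by apply: solvable_within_weaken same => // c Kc.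
exists (Query u v s d); split=> [|c Kc /=]; first by rewrite /= uv sG dG.
by case: (eqVneq (c u) (c v)) => Ecuv; [apply: sP | apply: dP].
Qed.

(** * The graph *)

(** The left ends of the intervals without a sibling: at level [j] the intervals
    of length [2 ^ j] are numbered from [0] to [(n %/ 2 ^ j).-1], and the last one
    has no sibling exactly when their number is odd. *)
Definition hubs (n : nat) : seq nat :=
  [seq (n %/ 2 ^ j).-1 * 2 ^ j | j <- iota 0 n & odd (n %/ 2 ^ j)].

(** Clearing the lowest binary digit [1] leads from the left end of a right
    sibling, at any level, to the left end of its left sibling
    ([parent_sibling]). *)
Definition parent (p : nat) : nat := p - p`_2.

Definition hub_tree_adj (n : nat) : rel 'I_n := fun u v =>
  (u != v) && [|| val u \in hubs n, val v \in hubs n,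
                  val u == parent v | val v == parent u].

Lemma hub_tree_sym n : symmetric (@hub_tree_adj n).
Proof.
move=> u v; rewrite /hub_tree_adj eq_sym; congr (_ && _).
by rewrite orbCA; do 2 congr (_ || _); rewrite orbC.
Qed.

Lemma hub_tree_irrefl n : irreflexive (@hub_tree_adj n).
Proof. by move=> u; rewrite /hub_tree_adj eqxx. Qed.

Definition hub_tree (n : nat) : sgraph 'I_n :=
  SGraph (@hub_tree_sym n) (@hub_tree_irrefl n).

Lemma size_hubs n : size (hubs n) = binary_ones n.
Proof.
rewrite size_map size_filter -sum1_count big_mkcond /= /binary_ones.
by rewrite -{1}[n]subn0 -/(index_iota 0 n) big_mkord; apply: eq_bigr => i _; case: odd.
Qed.

Lemma card_edges_hub_tree n : #|edges (hub_tree n)| <= n * (1 + binary_ones n).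
Proof.
pose H := [set u : 'I_n | val u \in hubs n].
pose star := [set [set p.1; p.2] | p in setX H [set: 'I_n]].
pose tree := [set [set v; insubd v (parent v)] | v : 'I_n in [set: 'I_n]].
have sub : edges (hub_tree n) \subset tree :|: star.
  apply/subsetP => e /imset2P[u v _]; rewrite inE /= => uv ->.
  have parentE (x y : 'I_n) : val x == parent y -> insubd y (parent y) = x.
    by move=> /eqP <-; apply: val_inj; rewrite val_insubd ltn_ord.
  rewrite inE; case/and3P: uv => _ _ /or4P[] uv; apply/orP.
  - by right; apply/imsetP; exists (u, v); rewrite ?inE ?andbT.
  - right; apply/imsetP; exists (v, u); rewrite ?inE ?andbT //=; exact: setUC.
  - left; apply/imsetP; exists v; rewrite ?inE // (parentE _ _ uv); exact: setUC.
  - by left; apply/imsetP; exists u; rewrite ?inE // (parentE _ _ uv).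
have card_H : #|H| <= binary_ones n.
  rewrite -size_hubs cardE -(size_map val); apply: uniq_leq_size.
    by rewrite (map_inj_uniq val_inj) enum_uniq.
  by move=> p /mapP[u]; rewrite mem_enum inE => uH ->.
apply: leq_trans (subset_leq_card sub) _; apply: leq_trans (leq_card_setU _ _).1 _.
rewrite mulnDr muln1; apply: leq_add.
  by apply: leq_trans (leq_imset_card _ _) _; rewrite cardsT card_ord.
apply: leq_trans (leq_imset_card _ _) _; rewrite cardsX cardsT card_ord mulnC.
by rewrite leq_mul2l card_H orbT.
Qed.

Lemma parent_sibling m j : parent (m.*2.+1 * 2 ^ j) = m * 2 ^ j.+1.
Proof.
rewrite /parent p_part lognM ?expn_gt0 // pfactorK //.
rewrite logn_coprime ?coprime2n /= ?odd_double //.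
by rewrite add0n mulSn addKn expnS -muln2 mulnA.
Qed.

Lemma last_block_hub n j N :
  N = n %/ 2 ^ j -> odd N -> N.-1 * 2 ^ j \in hubs n.
Proof.
move=> EN odd_N; apply/mapP; exists j; last by rewrite -EN.
rewrite mem_filter mem_iota -EN odd_N /= add0n.
have : 0 < n %/ 2 ^ j by rewrite -EN; case: N odd_N {EN}.
by rewrite divn_gt0 ?expn_gt0 //; apply: leq_trans (ltn_expl _ _).
Qed.

Lemma exists_hub n : 0 < n -> exists h : 'I_n, val h \in hubs n.
Proof.
move=> n_gt0; have /andP[lo hi] := trunc_log_bounds (isT : 1 < 2) n_gt0.
have one : n %/ 2 ^ trunc_log 2 n = 1.
  apply/eqP; rewrite eqn_leq divn_gt0 ?expn_gt0 // lo andbT.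
  by rewrite -ltnS ltn_divLR ?expn_gt0 // -expnS.
by exists (Ordinal n_gt0); apply: (last_block_hub (esym one)).
Qed.

(** * One level of the algorithm *)

Section Levels.

Variable n : nat.
Notation V := 'I_n.
Notation G := (hub_tree n).
Notation b := binary_ones.

(** [Some v] is an alive node, a cluster of weight [2 ^ j] whose colour is that of
    [v]; [None] is a dead one. The cluster need not consist of vertices of the
    interval number [i], since a cluster represented by a hub can be put in any
    slot. *)
Definition proper_rep (j i : nat) (x : option V) : Prop :=
  if x is Some v then val v = i * 2 ^ j \/ val v \in hubs n else True.

Fixpoint proper (j i : nat) (l : seq (option V)) : Prop :=
  if l is x :: l' then proper_rep j i x /\ proper j i.+1 l' else True.

Lemma proper_cat j i l1 l2 :
  proper j i (l1 ++ l2) <-> proper j i l1 /\ proper j (i + size l1) l2.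
Proof.
elim: l1 i => [|x l1 IH] i /=; first by rewrite addn0; tauto.
by rewrite IH addSnnS; tauto.
Qed.

Lemma proper_nth j i l :
  (forall m, m < size l -> proper_rep j (i + m) (nth None l m)) -> proper j i l.
Proof.
elim: l i => //= x l IH i rep; split; first by have := rep 0 isT; rewrite addn0.
by apply: IH => m lt_m; rewrite addSnnS; apply: (rep m.+1).
Qed.

Lemma siblings_adj j m u v :
  proper_rep j m.*2 (Some u) -> proper_rep j m.*2.+1 (Some v) ->
  (u == v) || adj G u v.
Proof.
rewrite /= /hub_tree_adj; case: (eqVneq u v) => //= _.
case=> [uE | ->]; last by rewrite ?orbT.
case=> [vE | ->]; last by rewrite ?orbT.
by rewrite uE vE parent_sibling -muln2 -mulnA -expnS eqxx ?orbT.
Qed.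

Lemma hub_adj h v : val h \in hubs n -> (h == v) || adj G h v.
Proof. by move=> hH; rewrite /= /hub_tree_adj hH /= andbT orbN. Qed.

Definition rep_sign (c : coloring V) (x : option V) : int :=
  (if x is Some v then sign (c v) else 0)%R.

Definition rep_sum (c : coloring V) (l : seq (option V)) : int :=
  (\sum_(x <- l) rep_sign c x)%R.

Definition alive (l : seq (option V)) : nat := count isSome l.
Definition dead (l : seq (option V)) : nat := count (fun x => ~~ isSome x) l.

(** The balance is [S] up to the clusters set aside: none if [o = None], and
    otherwise a nonzero amount, smaller than [B], with the sign of [x]. *)
Definition accounted (B : nat) (o : option V) (S : int) (c : coloring V) : Prop :=
  (if o is Some x then 0 < sign (c x) * (balance c - S) < B%:Z
   else balance c = S :> int)%R.

Lemma rep_sum_cons c x l : rep_sum c (x :: l) = (rep_sign c x + rep_sum c l)%R.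
Proof. exact: big_cons. Qed.

Lemma rep_sum_cat c l1 l2 :
  rep_sum c (l1 ++ l2) = (rep_sum c l1 + rep_sum c l2)%R.
Proof. exact: big_cat. Qed.

Lemma sign_neq (b1 b2 : bool) : b1 != b2 -> sign b1 = (- sign b2)%R.
Proof. by case: b1; case: b2. Qed.

Lemma accounted_norm B o S c :
  0 < B -> accounted B o S c -> (`|balance c - S| < B)%N.
Proof.
by case: o => [x|] /=; rewrite /sign; [case: (c x); lia | move=> B_gt0 ->; lia].
Qed.

Lemma accounted_widen B B' o S c :
  B <= B' -> accounted B o S c -> accounted B' o S c.
Proof. by case: o => [x|] //= le_B; lia. Qed.

(** A cluster of weight [B] dominates all those set aside before it. *)
Lemma accounted_set_aside B o (S : int) (v : V) (c : coloring V) : 0 < B ->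
  accounted B o (S + B%:Z * sign (c v))%R c -> accounted (2 * B) (Some v) S c.
Proof.
move=> B_gt0 /(accounted_norm B_gt0) /=; rewrite /sign; case: (c v); lia.
Qed.

(** Once the accumulator is the only cluster left besides those set aside, it
    decides if its weight [a * B] is nonzero, and [o] decides otherwise. The
    vertex [g] is a witness for the colour opposite to [h], needed as an answer
    when [h] is found to be in the minority. *)
Lemma solvable_at_end B o (a : int) h g (K : coloring V -> Prop) q :
  0 < B ->
  (forall c, K c -> accounted B o (a * B%:Z * sign (c h))%R c) ->
  ((a < 0)%R -> forall c, K c -> c g != c h) ->
  solvable_within G K q.
Proof.
move=> B_gt0 acc opp.
have answer (ans : option V) : (forall c, K c -> correct_output c ans) ->
    solvable_within G K q.
  by move=> ok; exists (Answer ans); split=> // c Kc; split=> //; apply: ok.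
case: (ltrgt0P a) => a0.
- apply: (answer (Some h)) => c Kc /=; rewrite majority_vertexE.
  have := accounted_norm B_gt0 (acc c Kc).
  have : (B%:Z <= a * B%:Z)%R by nia.
  by move: (a * _)%R => p; rewrite /sign; case: (c h); lia.
- apply: (answer (Some g)) => c Kc /=; rewrite majority_vertexE.
  have := accounted_norm B_gt0 (acc c Kc).
  have : (a * B%:Z <= - B%:Z)%R by nia.
  move: (a * _)%R (opp a0 c Kc) => p.
  by rewrite /sign; case: (c h); case: (c g) => //; lia.
apply: (answer o) => c Kc; have := acc c Kc; rewrite a0 !mul0r.
case: o {acc} => [x|] /=; first by rewrite subr0 majority_vertexE => /andP[].
by move=> t0 v; rewrite majority_vertexE t0 mulr0.
Qed.

(** The [k] pairs of siblings in [todo] are treated one by one, which appends their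
    parents to [ready], at the price of one query each. The bound on [a] weighs a
    dead parent as two dead nodes: a lone node that is absorbed changes [|a|] by at
    most one and this weighted count by exactly one. The slack of one unit, which
    covers a node outside the pairs, is lost in the final halving because [a] is
    then even. *)
Lemma solvable_pairs j o (h : V) (q : nat) k (todo ready : seq (option V)) (a : int) g
    (K : coloring V -> Prop) :
  val h \in hubs n ->
  (forall l (a' : int) g' (K' : coloring V -> Prop),
     size l = k + size ready -> proper j.+1 0 l ->
     (`|a'| <= dead l)%N ->
     (forall c, K' c -> accounted (2 ^ j.+1) o
        (a' * (2 ^ j.+1)%:Z * sign (c h) + (2 ^ j.+1)%:Z * rep_sum c l)%R c) ->
     ((a' < 0)%R -> forall c, K' c -> c g' != c h) ->
     solvable_within G K' q) ->
  size todo = k.*2 ->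
  proper j.+1 0 ready -> proper j (size ready).*2 todo ->
  (`|a| <= (dead ready).*2 + dead todo + 1)%N ->
  ~~ odd (`|a| + alive todo)%N ->
  (forall c, K c -> accounted (2 ^ j.+1) o
     (a * (2 ^ j)%:Z * sign (c h) + (2 ^ j.+1)%:Z * rep_sum c ready
      + (2 ^ j)%:Z * rep_sum c todo)%R c) ->
  ((a < 0)%R -> forall c, K c -> c g != c h) ->
  solvable_within G K (k + q).
Proof.
move=> hH; elim: k todo ready a g K => [|k IH] todo ready a g K next.
  move=> /size0nil -> pr _ bound even acc opp.
  have [a' Ea] : exists a', a = (2 * a')%R.
    by exists (a %/ 2)%Z; move: even; rewrite /= addn0; lia.
  apply: (next ready a' g) => // [|c /acc|a0].
  - by move: bound; rewrite Ea /=; lia.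
  - rewrite Ea /rep_sum big_nil mulr0 addr0.
    by congr (accounted _ _ (_ + _)%R _); rewrite expnS PoszM; ring.
  - by apply: opp; lia.
case: todo => [//|x [//|y todo]] [sz] pr_ready [repx [repy pr_todo]].
move=> bound even acc opp.
(* The conclusion for the pair [x], [y] once it has been replaced by [z]. *)
have step (z : option V) (a' : int) g' (K' : coloring V -> Prop) :
    proper_rep j.+1 (size ready) z ->
    (`|a'| <= (dead ready + ~~ isSome z).*2 + dead todo + 1)%N ->
    ~~ odd (`|a'| + alive todo)%N ->
    (forall c, K' c ->
       K c /\ (a' * sign (c h) + 2 * rep_sign c z =
         a * sign (c h) + rep_sign c x + rep_sign c y)%R) ->
    ((a' < 0)%R -> forall c, K' c -> c g' != c h) ->
    solvable_within G K' (k + q).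
  move=> repz bound' even' acc' opp'.
  apply: (IH todo (rcons ready z) a' g') => //.
  - by move=> l a1 g1 K1 sz1; apply: next; rewrite sz1 size_rcons addSnnS.
  - by rewrite -cats1 proper_cat /= add0n.
  - by rewrite size_rcons doubleS.
  - by rewrite /dead -cats1 count_cat /= addn0.
  - move=> c /acc'[/acc + Ez].
    rewrite !rep_sum_cons -cats1 rep_sum_cat rep_sum_cons /rep_sum !big_nil.
    congr (accounted _ _ _ _); rewrite -!/(rep_sum _ _) expnS PoszM.
    move: Ez => /(congr1 (fun r => (2 ^ j)%N%:Z * r)%R) Ez.
    apply/eqP; rewrite -subr_eq0; apply/eqP.
    rewrite -[RHS](subrr ((2 ^ j)%N%:Z *
      (a * sign (c h) + rep_sign c x + rep_sign c y))%R).
    by rewrite -[in X in (_ = _ - X)%R]Ez; ring.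
(* A lone node [v] is compared with the accumulator; after DIFF, [v] is a new
   witness for the colour opposite to [h]. *)
have absorb (v : V) :
    (forall c, rep_sign c x + rep_sign c y = sign (c v))%R ->
    dead [:: x; y] = 1 -> solvable_within G K (k.+1 + q).
  move=> xyE dxy; rewrite addSn.
  have alive_xy : alive [:: x; y] = 1 by case: (x) dxy; case: (y).
  have {}bound : (`|a| <= (dead ready).*2 + 1 + dead todo + 1)%N.
    move: bound; rewrite /dead -cat1s -[y :: _]cat1s catA count_cat.
    by rewrite -/(dead [:: x; y]) dxy; lia.
  have {}even : ~~ odd (`|a| + 1 + alive todo)%N.
    move: even; rewrite /alive -cat1s -[y :: _]cat1s catA count_cat.
    by rewrite -/(alive [:: x; y]) alive_xy addnA.
  apply: (solvable_within_query (u := h) (v := v)); first exact: hub_adj.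
  - apply: (step None (a + 1)%R g) => //=; try lia.
    + by move=> c [Kc Eh]; split=> //; rewrite -addrA xyE Eh; ring.
    + by move=> a0 c [Kc _]; apply: opp Kc; lia.
  - apply: (step None (a - 1)%R v) => //=; try lia.
    + by move=> c [Kc /sign_neq Eh]; split=> //; rewrite -addrA xyE Eh; ring.
    + by move=> _ c [_]; rewrite eq_sym.
case: x y repx repy bound even absorb step {acc} =>
  [u|] [v|] repx repy bound even absorb step.
- rewrite addSn; apply: (solvable_within_query (u := u) (v := v)).
  + exact: siblings_adj repx repy.
  + apply: (step (Some u) a g) => //.
    * by case: repx => [uE | ?]; [left; rewrite uE -muln2 -mulnA -expnS | right].
    * by move: bound => /=; rewrite addn0.
    * by move: even; rewrite /= !addnS /= negbK.
    * by move=> c [Kc /= ->]; split=> //; ring.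
    * by move=> a0 c [Kc _]; apply: opp a0 c Kc.
  + apply: (step None a g) => //.
    * by move: bound => /=; lia.
    * by move: even; rewrite /= !addnS /= negbK.
    * by move=> c [Kc /= /sign_neq ->]; split=> //; ring.
    * by move=> a0 c [Kc _]; apply: opp a0 c Kc.
- by apply: (absorb u) => // c; rewrite /= addr0.
- by apply: (absorb v) => // c; rewrite /= add0r.
- apply: (@solvable_within_weaken _ _ K _ (k + q)) => //.
  apply: (step None a g) => //.
  + by move: bound => /=; lia.
  + by move=> c Kc; split=> //=; ring.
Qed.

Lemma proper_replace j i p1 x y p2 :
  proper_rep j (i + size p1) y -> proper j i (p1 ++ x :: p2) ->
  proper j i (p1 ++ y :: p2).
Proof. by move=> repy; rewrite !proper_cat /=; tauto. Qed.

Lemma dead_split l : 0 < dead l -> exists p1 p2, l = p1 ++ None :: p2.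
Proof.
rewrite -has_count => /hasP[[v|] //] /splitPr[p1 p2] _.
by exists p1, p2.
Qed.

Lemma alive_split l : 0 < alive l -> exists p1 v p2, l = p1 ++ Some v :: p2.
Proof.
rewrite -has_count => /hasP[[v|] //] /splitPr[p1 p2] _.
by exists p1, v, p2.
Qed.

Lemma rep_sum_dead c l : alive l = 0 -> rep_sum c l = 0%R.
Proof.
move=> l0; rewrite /rep_sum big1_seq // => -[v|] //= vl.
by have : has isSome l; [apply/hasP; exists (Some v) | rewrite has_count -/(alive l) l0].
Qed.

Lemma dead_alive l : dead l + alive l = size l.
Proof. by rewrite addnC count_predC. Qed.

(** The strategy from level [j] on. The hypothesis [|a| <= dead l] is what
    guarantees a dead slot for the unpaired node when the number of units is
    even. *)
Lemma solvable_levels N j (l : seq (option V)) o (h : V) (a : int) g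
    (K : coloring V -> Prop) :
  val h \in hubs n -> N = n %/ 2 ^ j -> size l = N -> proper j 0 l ->
  (`|a| <= dead l)%N ->
  (forall c, K c -> accounted (2 ^ j) o
     (a * (2 ^ j)%:Z * sign (c h) + (2 ^ j)%:Z * rep_sum c l)%R c) ->
  ((a < 0)%R -> forall c, K c -> c g != c h) ->
  solvable_within G K (N - b N).
Proof.
move=> hH; elim/ltn_ind: N j l o a g K => N IHN j l o a g K EN sz pr bound acc opp.
case: (posnP N) => [N0|N_gt0].
  apply: (@solvable_at_end (2 ^ j) o a h g) => //; first by rewrite expn_gt0.
  by move=> c /acc; rewrite (size0nil (etrans sz N0)) /rep_sum big_nil mulr0 addr0.
(* The pairs form [p] and the unpaired last node is [t]. For even [N] there is no
   such node, and [t = None] is harmless since it counts for nothing but a slack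
   of one in the bound on [a]. *)
have [p [t [sz_p pr_p t_hub [bound_p sum_p]]]] : exists p t,
    [/\ size p = N./2.*2, proper j 0 p, (forall v, t = Some v -> val v \in hubs n) &
     (`|a| <= dead p + ~~ isSome t)%N /\
     forall c, rep_sum c l = (rep_sum c p + rep_sign c t)%R].
  case/boolP: (odd N) => odd_N.
    case/lastP: l => [|p t] in sz pr bound acc *; first by rewrite -sz in odd_N.
    move: sz pr; rewrite size_rcons -cats1 proper_cat /= add0n => sz [pr [rep_t _]].
    exists p, t; split=> //.
    - lia.
    - move=> v Et; move: rep_t; rewrite Et; case=> // ->.
      have -> : size p = N.-1 by lia.
      exact: last_block_hub EN odd_N.
    - split=> [|c].
      + by move: bound; rewrite /dead -cats1 count_cat /= addn0.
      + by rewrite rep_sum_cat rep_sum_cons /rep_sum big_nil addr0.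
  exists l, None; split=> //; first lia.
  by split=> [|c]; rewrite ?addr0 //; lia.
have pass o' p' : size p' = N./2.*2 -> proper j 0 p' ->
    (`|a| <= dead p' + 1)%N -> ~~ odd (`|a| + alive p')%N ->
    (forall c, K c -> accounted (2 ^ j.+1) o'
       (a * (2 ^ j)%:Z * sign (c h) + (2 ^ j)%:Z * rep_sum c p')%R c) ->
    solvable_within G K (N - b N).
  move=> sz' pr' bound' even' acc'.
  have -> : N - b N = N./2 + (N./2 - b N./2).
    by have := binary_ones_leq N./2; rewrite (binary_ones_half N); lia.
  apply: (@solvable_pairs j o' h (N./2 - b N./2) N./2 p' [::] a g) => //.
  - move=> l1 a1 g1 K1; rewrite addn0 => sz1 pr1 bound1 acc1 opp1.
    apply: (IHN N./2 _ j.+1 l1 o' a1 g1) => //; first lia.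
    by rewrite EN -divn2 -divnMA -expnSr.
  - by move=> c /acc'; rewrite [rep_sum c [::]]/rep_sum big_nil mulr0 addr0.
have pow_gt0 : 0 < 2 ^ j by rewrite expn_gt0.
have pass_aside p' v : size p' = N./2.*2 -> proper j 0 p' ->
    (`|a| <= dead p' + 1)%N -> ~~ odd (`|a| + alive p')%N ->
    (forall c, rep_sum c l = rep_sum c p' + sign (c v))%R ->
    solvable_within G K (N - b N).
  move=> sz' pr' bound' even' sum'; apply: (pass (Some v) p') => // c /acc.
  by rewrite sum' mulrDr addrA expnS; apply: accounted_set_aside.
have pass_same p' : size p' = N./2.*2 -> proper j 0 p' ->
    (`|a| <= dead p' + 1)%N -> ~~ odd (`|a| + alive p')%N ->
    (forall c, rep_sum c l = rep_sum c p') ->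
    solvable_within G K (N - b N).
  move=> sz' pr' bound' even' sum'; apply: (pass o p') => // c /acc.
  by rewrite sum'; apply: accounted_widen; rewrite leq_exp2l.
have count_replace (f : pred (option V)) p1 x p2 :
    count f (p1 ++ x :: p2) = f x + count f (p1 ++ p2).
  by rewrite !count_cat /= addnCA.
have size_replace p1 (x y : option V) p2 : size (p1 ++ x :: p2) = size (p1 ++ y :: p2).
  by rewrite !size_cat.
have sum_replace c p1 x p2 :
    rep_sum c (p1 ++ x :: p2) = (rep_sign c x + rep_sum c (p1 ++ p2))%R.
  by rewrite !rep_sum_cat rep_sum_cons addrCA.
(* The parity of the number of units is that of [|a| + alive p], plus one if [t]
   is alive. *)
case: t => [v|] in t_hub bound_p sum_p *; last first.
  case: (boolP (odd (`|a| + alive p))) => par; last first.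
    by apply: (pass_same p) => // c; rewrite sum_p addr0.
  (* Any alive node will do: whether it was lone or paired, setting it aside
     flips the parity. *)
  case: (posnP (alive p)) => [p0|/alive_split[p1 [v [p2 Ep]]]].
    apply: (@solvable_at_end (2 ^ j) o a h g) => // c /acc.
    by rewrite sum_p rep_sum_dead // !addr0 mulr0 addr0.
  rewrite {}Ep in sz_p pr_p bound_p sum_p par.
  apply: (pass_aside (p1 ++ None :: p2) v).
  - by rewrite -sz_p; apply: size_replace.
  - exact: proper_replace pr_p.
  - by move: bound_p; rewrite /dead !count_replace /=; lia.
  - by move: par; rewrite /alive !count_replace /=; lia.
  - by move=> c; rewrite sum_p !sum_replace /= addr0 add0r addrC.
case: (boolP (odd (`|a| + alive p))) => par; last first.
  by apply: (pass_aside p v) => //; lia.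
have : 0 < dead p.
  by rewrite lt0n; apply/eqP => p0; have := dead_alive p; move: par bound_p => /=; lia.
(* If the dead slot filled by [v] has an alive sibling, the two will be compared;
   otherwise [v] will be absorbed, on the query saved by a dead pair. *)
case/dead_split=> p1 [p2 Ep]; rewrite {}Ep in sz_p pr_p bound_p sum_p par.
apply: (pass_same (p1 ++ Some v :: p2)).
- by rewrite -sz_p; apply: size_replace.
- by apply: proper_replace pr_p; right; apply: t_hub.
- by move: bound_p; rewrite /dead !count_replace /=; lia.
- by move: par; rewrite /alive !count_replace /=; lia.
- by move=> c; rewrite sum_p !sum_replace /= add0r addrC.
Qed.

(** Initially the accumulator is the vertex [h] alone, with weight [1], and the
    slot of [h] is the only dead one. *)
Lemma solvable_hub_tree :
  0 < n -> solvable_within G (fun=> True) (n - b n).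
Proof.
case/exists_hub=> h hH.
pose node (i : V) := if i == h then None else Some i.
apply: (@solvable_levels n 0 [seq node i | i <- enum V] None h 1 h) => //.
- by rewrite divn1.
- by rewrite size_map size_enum_ord.
- apply: proper_nth => i; rewrite size_map size_enum_ord => lt_i.
  rewrite (nth_map h) ?size_enum_ord // /node; case: eqP => // _; left.
  by rewrite /= nth_enum_ord // muln1.
- rewrite /dead -has_count has_map; apply/hasP; exists h; rewrite ?mem_enum //=.
  by rewrite /node eqxx.
- move=> c _ /=; rewrite !mul1r /balance (bigD1 h) //=; congr (_ + _)%R.
  rewrite /rep_sum big_map big_enum big_mkcond /=; apply: eq_bigr => i _.
  by rewrite /node; case: eqP.
Qed.

End Levels.

Theorem theorem1p2 (n : nat) (n_gt0 : 0 < n) :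
  exists G : sgraph 'I_n,
    [/\ #|edges G| <= n * (1 + binary_ones n),
        majority_solvable G
      & majority_complexity G (n - binary_ones n)].
Proof.
have lower (t : algorithm 'I_n) : solves_majority (hub_tree n) t ->
    n - binary_ones n <= worst_case t.
  by move/(worst_case_lower (Ordinal n_gt0)); rewrite card_ord.
have [t [tG tP]] := solvable_hub_tree n_gt0.
have t_solves : solves_majority (hub_tree n) t.
  by split=> // c; have [] := tP c I.
exists (hub_tree n); split; [exact: card_edges_hub_tree | by exists t | split=> //].
exists t; split=> //; apply/eqP; rewrite eqn_leq lower // andbT.
by apply/bigmax_leqP => c _; have [] := tP c I.
Qed.
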